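(* Let $\alpha\in\mathbb N$, $k\in\mathbb Z_+$, let $d\in\mathbb N$ with $(p,d)=1$, and let $\chi$ be a Dirichlet character with conductor $d$. For $\beta\,(\neq1)\in X^*$, we have $$\int_X\chi(x)\,d\mu_{k,q}^{(\alpha)}(x)=\widetilde\beta_{k,\chi,q}^{(\alpha)},$$ $$\int_{pX}\chi(x)\,d\mu_{k,q}^{(\alpha)}(x)=\chi(p)\frac{[p]_{q^\alpha}^k}{[p]_q}\,\widetilde\beta_{k,\chi,q^p}^{(\alpha)},$$ $$\int_{pX}\chi(x)\,d\mu_{k,q^{1/\beta}}^{(\alpha)}(\beta x)=\chi\left(\frac p\beta\right)\frac{[p]_{q^{\alpha/\beta}}^k}{[p]_{q^{1/\beta}}}\,\widetilde\beta_{k,\chi,q^{p/\beta}}^{(\alpha)},$$ $$\int_X\chi(x)\,d\mu_{k,q^{1/\beta}}^{(\alpha)}(\beta x)=\chi\left(\frac1\beta\right)\widetilde\beta_{k,\chi,q^{1/\beta}}^{(\alpha)}.$$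
   Context: $p$ is a fixed prime; $\mathbb C_p$ is the completion of an algebraic closure of $\mathbb Q_p$, with $|p|_p=1/p$. $\mathbb N$ is the set of positive integers, $\mathbb Z_+=\mathbb N\cup\{0\}$. $q\in\mathbb C_p$ satisfies $|1-q|_p<1$. $[x]_Q=\frac{1-Q^x}{1-Q}$ (so that $\lim_{Q\to1}[x]_Q=x$), and $[x]_Q^k$ means $([x]_Q)^k$. $X=X_d=\varprojlim_N(\mathbb Z/dp^N\mathbb Z)$, $a+dp^N\mathbb Z_p$ denotes $\{x\in X:x\equiv a\pmod{dp^N}\}$, and $X^*=\bigcup_{0<a<dp,\,(a,p)=1}(a+dp\mathbb Z_p)$; also $pX=\{px:x\in X\}$. The character $\chi$ is viewed as a function on $X$ through reduction modulo $d$, and $\chi(1/\beta),\chi(p/\beta)$ denote its values at $1/\beta$ and $p/\beta$. In exponents such as $1/\beta$, $p/\beta$, $\alpha/\beta$, $\beta$ stands for its image in $\mathbb Z_p$. The $q$-Bernoulli numbers with weight $\alpha$, $\widetilde\beta_{n,q}^{(\alpha)}$, are defined recursively by $\widetilde\beta_{0,q}^{(\alpha)}=1$ and, for $n\ge1$, $q\,(q^\alpha\widetilde\beta^{(\alpha)}+1)^n-\widetilde\beta_{n,q}^{(\alpha)}=\frac{\alpha}{[\alpha]_q}$ if $n=1$ and $=0$ if $n>1$, where after binomial expansion $(\widetilde\beta^{(\alpha)})^l$ is replaced by $\widetilde\beta_{l,q}^{(\alpha)}$. The $q$-Bernoulli polynomials with weight $\alpha$ are $\widetilde\beta_{n,q}^{(\alpha)}(x)=\sum_{l=0}^n\binom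 nl[x]_{q^\alpha}^{n-l}q^{\alpha l x}\,\widetilde\beta_{l,q}^{(\alpha)}$. Replacing $q$ by $q^M$ gives $\widetilde\beta_{n,q^M}^{(\alpha)}(x)$; at $x=a/M$ one takes $(q^M)^{a/M}=q^a$. The distribution $\mu_{k,q}^{(\alpha)}$ on the compact open subsets of $X$ is given by $\mu_{k,q}^{(\alpha)}(a+dp^N\mathbb Z_p)=\frac{[dp^N]_{q^\alpha}^k}{[dp^N]_q}\,q^a\,\widetilde\beta_{k,q^{dp^N}}^{(\alpha)}\left(\frac a{dp^N}\right)$, $0\le a<dp^N$, $N\in\mathbb Z_+$. The generalized $q$-Bernoulli numbers with weight $\alpha$ attached to $\chi$ are $$\widetilde\beta_{n,\chi,q}^{(\alpha)}=\int_X\chi(x)[x]_{q^\alpha}^n\,d\mu_q(x)=\frac{[d]_{q^\alpha}^n}{[d]_q}\sum_{a=0}^{d-1}q^a\chi(a)\,\widetilde\beta_{n,q^d}^{(\alpha)}\left(\frac ad\right),$$ where $\int_X f\,d\mu_q=\lim_{N\to\infty}\frac1{[dp^N]_q}\sum_{x=0}^{dp^N-1}f(x)q^x$. These objects are also used with $q$ replaced by $q^p$, $q^{1/\beta}$, $q^{p/\beta}$. For a distribution $\mu$, $\int_X\chi\,d\mu=\lim_{N\to\infty}\sum_{x=0}^{dp^N-1}\chi(x)\mu(x+dp^N\mathbb Z_p)$ and $\int_{pX}\chi\,d\mu=\lim_{N\to\infty}\sum_{x=0}^{dp^N-1}\chi(px)\mu(px+dp^{N+1}\mathbb Z_p)$.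 The notation $d\mu(\beta x)$ means integration against $U\mapsto\mu(\beta U)$. *)

(* Defs.v *)
From HB Require Import structures.
From mathcomp Require Import all_boot all_order all_algebra.
From mathcomp Require Import boolp classical_sets reals.
Set Implicit Arguments. Unset Strict Implicit. Unset Printing Implicit Defensive.
Import Order.TTheory GRing.Theory Num.Theory.
Local Open Scope classical_set_scope.
Local Open Scope ring_scope.

Section Valued.
Variables (R : realType) (K : fieldType) (nv : K -> R).

Definition pcvg (u : nat -> K) (l : K) : Prop :=
  forall e : R, 0 < e -> exists N : nat, forall n, (N <= n)%N -> nv (u n - l) < e.

Definition pcauchy (u : nat -> K) : Prop :=
  forall e : R, 0 < e ->
    exists N : nat, forall m n, (N <= m)%N -> (N <= n)%N -> nv (u m - u n) < e.

(* The limit, and 0 for a divergent sequence. *)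
Definition plim (u : nat -> K) : K := xget 0 [set l | pcvg u l].

(* The closure of the rationals in K: a copy of Q_p once K is complete and nv
   restricts to the p-adic absolute value. *)
Definition Qp_in : set K := [set x | exists u : nat -> rat, pcvg (ratr \o u) x].

Definition Qpbar_in : set K :=
  [set x | exists P : {poly K}, [/\ P != 0, (forall i, Qp_in P`_i) & root P x]].

(* (K, nv) is C_p: a complete ultrametric field in which the elements algebraic
   over Q_p form an algebraic closure of Q_p and are dense. By Ostrowski's
   theorem, nv p = 1/p forces nv to be the p-adic absolute value on Q. This
   determines (K, nv) up to isometric isomorphism. *)
Record is_Cp (p : nat) : Prop := IsCp {
  Cp_ge0 : forall x, 0 <= nv x;
  Cp_eq0 : forall x, nv x = 0 <-> x = 0;
  Cp_mul : forall x y, nv (x * y) = nv x * nv y;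
  Cp_ultra : forall x y, nv (x + y) <= Num.max (nv x) (nv y);
  Cp_norm_p : nv p%:R = p%:R^-1;
  Cp_complete : forall u, pcauchy u -> exists l, pcvg u l;
  Cp_closed : forall P : {poly K}, (1 < size P)%N -> (forall i, Qpbar_in P`_i) ->
    exists2 x, Qpbar_in x & root P x;
  Cp_dense : forall (x : K) (e : R), 0 < e -> exists2 y, Qpbar_in y & nv (x - y) < e
}.

End Valued.

(* A Dirichlet character of modulus d, as a function of residues, whose conductor
   is d itself: for no proper divisor f of d is it trivial on the units
   congruent to 1 modulo f. *)
Record dirichlet_of_conductor (K : fieldType) (d : nat) (chi : nat -> K) : Prop :=
  DirichletOfConductor {
  dir_period : forall m n, m = n %[mod d] -> chi m = chi n;
  dir_one : chi 1%N = 1;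
  dir_mul : forall m n, chi (m * n)%N = chi m * chi n;
  dir_supp : forall n, (chi n != 0) = coprime n d;
  dir_prim : forall f : nat, (f %| d)%N -> (f < d)%N ->
    exists n, [/\ coprime n d, n = 1 %[mod f] & chi n <> 1]
}.

(* The representative in [0, m) of the inverse of b modulo m, when b and m are
   coprime. *)
Definition inv_mod (m b : nat) : nat := ((egcdn b m).1 %% m)%N.

Lemma inv_modP m b : (0 < m)%N -> coprime b m -> (b * inv_mod m b = 1 %[mod m])%N.
Proof.
move=> m_gt0 cop; rewrite /inv_mod modnMmr.
have [b0|b_gt0] := posnP b.
  move: cop; rewrite b0 /coprime gcd0n => /eqP ->; by rewrite !modn1.
case: egcdnP => //= u v def_u _.
by rewrite mulnC def_u (eqP cop) modnMDl.
Qed.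

(* chi(a/b); when b is not invertible modulo d the value is 0, as for every
   other value of chi outside the units modulo d. *)
Definition chi_frac (K : fieldType) (d : nat) (chi : nat -> K) (a b : nat) : K :=
  if coprime b d then chi (a * inv_mod d b)%N else 0.

Section Xd.
Variable p : nat.

(* The inverse limit of the Z/dp^N. The component at N is represented by its
   residue in [0, dp^N): compatibility alone forces this when dp > 0. *)
Record Xd (d : nat) := MkXd {
  residue :> nat -> nat;
  residue_compat : forall N, (residue N.+1 %% (d * p ^ N) = residue N)%N
}.

Definition Zadic := Xd 1.

Variable d : nat.

Lemma dvd_level e N : (e * p ^ N %| e * p ^ N.+1)%N.
Proof. by rewrite dvdn_mul // expnS dvdn_mull. Qed.

Program Definition Xnat (n : nat) : Xd d := @MkXd d (fun N => n %% (d * p ^ N))%N _.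
Next Obligation. by rewrite modn_dvdm ?dvd_level. Qed.

Program Definition Xmul (x y : Xd d) : Xd d :=
  @MkXd d (fun N => (x N * y N) %% (d * p ^ N))%N _.
Next Obligation.
by rewrite modn_dvdm ?dvd_level // -modnMm !residue_compat.
Qed.

Program Definition toZadic (x : Xd d) : Zadic := @MkXd 1 (fun N => x N %% (1 * p ^ N))%N _.
Next Obligation.
rewrite modn_dvdm ?dvd_level // -(residue_compat x N) modn_dvdm //.
by rewrite mul1n dvdn_mull.
Qed.

(* a + dp^N Z_p *)
Definition Xball (N a : nat) : set (Xd d) := [set x | x N = a %[mod d * p ^ N]].

Definition Xstar : set (Xd d) :=
  \bigcup_(a in [set a : nat | (0 < a < d * p)%N && coprime a p]) Xball 1 a.

End Xd.

Section ZadicInverse.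
Variable p : nat.

Lemma Zadic_mod1 (y : Zadic p) N : (0 < N)%N -> (y N %% p = y 1%N)%N.
Proof.
have yE := residue_compat y.
elim: N => // -[_ _|N IH _].
  by rewrite -[RHS](residue_compat y) -[in LHS]yE modn_dvdm // mul1n expn1.
rewrite -IH // -(yE N.+1) modn_dvdm //.
by rewrite mul1n expnS dvdn_mulr.
Qed.

Lemma Zadic_coprime (y : Zadic p) N : coprime (y 1%N) p -> coprime (y N) (1 * p ^ N).
Proof.
move=> cop; case: N => [|N]; first by rewrite expn0 coprimen1.
by rewrite mul1n coprime_pexpr // -coprime_modl Zadic_mod1.
Qed.

(* The inverse of a unit of Z_p, and 0 on non-units. *)
Definition Zadic_inv_comp (y : Zadic p) (N : nat) : nat :=
  if (0 < p)%N && coprime (y 1%N) p then inv_mod (1 * p ^ N) (y N) else 0%N.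

Lemma Zadic_inv_subproof (y : Zadic p) N :
  (Zadic_inv_comp y N.+1 %% (1 * p ^ N) = Zadic_inv_comp y N)%N.
Proof.
rewrite /Zadic_inv_comp; case: ifP => [/andP[p_gt0 cop]|_]; last by rewrite mod0n.
have m_gt0 k : (0 < 1 * p ^ k)%N by rewrite mul1n expn_gt0 p_gt0.
have E1 := inv_modP (m_gt0 N.+1) (Zadic_coprime N.+1 cop).
have E0 := inv_modP (m_gt0 N) (Zadic_coprime N cop).
have {}E1 : (y N * inv_mod (1 * p ^ N.+1) (y N.+1) = 1 %[mod 1 * p ^ N])%N.
  rewrite -(residue_compat y N) modnMml -[LHS](@modn_dvdm (1 * p ^ N.+1)) ?dvd_level //.
  by rewrite E1 modn_dvdm ?dvd_level.
set u := inv_mod _ (y N.+1) in E1 *; set v := inv_mod _ (y N) in E0 *.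
have <- : (v %% (1 * p ^ N) = v)%N by rewrite /v /inv_mod modn_mod.
rewrite -[u]muln1 -modnMmr -E0 modnMmr mulnCA mulnA -modnMml.
by rewrite E1 modnMml mul1n.
Qed.

Definition Zadic_inv (y : Zadic p) : Zadic p := MkXd (Zadic_inv_subproof y).

Lemma Zadic_invP (y : Zadic p) N : (0 < p)%N -> coprime (y 1%N) p ->
  (y N * Zadic_inv y N = 1 %[mod 1 * p ^ N])%N.
Proof.
move=> p_gt0 cop; rewrite /= /Zadic_inv_comp p_gt0 cop /=.
by apply: inv_modP; [rewrite mul1n expn_gt0 p_gt0 | exact: Zadic_coprime].
Qed.

End ZadicInverse.

Section QCalculus.
Variables (R : realType) (K : fieldType) (nv : K -> R).

(* [x]_Q, given x and the value Qx of Q^x; at Q = 1 this is the limit value x. *)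
Definition qnum (Q Qx x : K) : K := if Q == 1 then x else (1 - Qx) / (1 - Q).

(* [n]_Q *)
Definition qint (Q : K) (n : nat) : K := qnum Q (Q ^+ n) n%:R.

(* Q^y for y in Z_p, by continuity from the exponents in nat. *)
Definition Zpow (p : nat) (Q : K) (y : Zadic p) : K := plim nv (fun N => Q ^+ y N).

Definition qbern_rec (alpha : nat) (Q : K) (b : nat -> K) : Prop :=
  b 0%N = 1 /\
  forall n : nat, (0 < n)%N ->
    Q * (\sum_(l < n.+1) (Q ^+ alpha) ^+ l * b l *+ 'C(n, l)) - b n
    = if n == 1%N then alpha%:R / qint Q alpha else 0.

(* The q-Bernoulli numbers with weight alpha. At Q = 1 the coefficient of b n in
   the n-th equation vanishes; the system then determines the classical
   Bernoulli numbers. *)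
Definition qbern (alpha : nat) (Q : K) : nat -> K :=
  xget (fun _ => 0) [set b | qbern_rec alpha Q b].

(* The n-th q-Bernoulli polynomial with weight alpha at x, Qx being the value of
   Q^x. *)
Definition qbern_poly (alpha n : nat) (Q Qx x : K) : K :=
  \sum_(l < n.+1)
    qnum (Q ^+ alpha) (Qx ^+ alpha) x ^+ (n - l) * Qx ^+ (alpha * l)
      * qbern alpha Q l *+ 'C(n, l).

Variables (p d : nat).

(* The value of mu_{k,q}^(alpha) on a + dp^N Z_p, for 0 <= a < dp^N. *)
Definition mu_ball (alpha k : nat) (q : K) (N a : nat) : K :=
  let M := (d * p ^ N)%N in
  qint (q ^+ alpha) M ^+ k / qint q M * q ^+ a
    * qbern_poly alpha k (q ^+ M) (q ^+ a) (a%:R / M%:R).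

(* The distribution mu_{k,q}^(alpha): its additive extension to the compact open
   subsets U of X. Every ball of a sufficiently high level is contained in U or
   disjoint from it, so additivity makes these sums eventually constant. *)
Definition mu (alpha k : nat) (q : K) (U : set (Xd p d)) : K :=
  plim nv (fun N => \sum_(a < d * p ^ N | `[< Xball (d := d) N a `<=` U >])
                      mu_ball alpha k q N a).

(* U |-> m(beta U) *)
Definition dilate (beta : Xd p d) (m : set (Xd p d) -> K) : set (Xd p d) -> K :=
  fun U => m (Xmul beta @` U).

Definition has_int_X (chi : nat -> K) (m : set (Xd p d) -> K) (I : K) : Prop :=
  pcvg nv (fun N => \sum_(x < d * p ^ N) chi x * m (Xball N x)) I.

Definition has_int_pX (chi : nat -> K) (m : set (Xd p d) -> K) (I : K) : Prop :=
  pcvg nv (fun N => \sum_(x < d * p ^ N) chi (p * x)%N * m (Xball N.+1 (p * x))) I.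

(* The integral over X against mu_q, of a function given on nat. *)
Definition volkenborn (q : K) (f : nat -> K) : K :=
  plim nv (fun N => (qint q (d * p ^ N))^-1 * \sum_(x < d * p ^ N) f x * q ^+ x).

(* The generalized q-Bernoulli numbers with weight alpha attached to chi. *)
Definition gen_qbern (alpha n : nat) (chi : nat -> K) (q : K) : K :=
  volkenborn q (fun x => chi x * qint (q ^+ alpha) x ^+ n).

End QCalculus.

Arguments mu {R K} nv p d alpha k q U.

(* Main.v *)
Require Import Defs.
From mathcomp Require Import all_boot all_order all_algebra.
From mathcomp Require Import boolp classical_sets reals.
From mathcomp Require Import ring lra zify.
Set Implicit Arguments. Unset Strict Implicit. Unset Printing Implicit Defensive.
Import Order.TTheory GRing.Theory Num.Theory.
Local Open Scope classical_set_scope.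
Local Open Scope ring_scope.

(** The key fact is that each value of the distribution is itself a limit of
    the kind that defines the integral against mu_q. With [x]_Q for qint Q x and
    M = d p^N,

      mu (a + M Z_p)
        = lim_n 1/[d p^n]_q (sum of [x]_{q^alpha}^k q^x, x < d p^n, x = a mod M)

    for a < M (mu_ball_cvg). By linearity, for every F periodic modulo M the sum
    of F a * mu (a + M Z_p) over a < M is the integral of F x * [x]_{q^alpha}^k
    against mu_q (mu_ball_sum_cvg). Taking for F the indicator of a coarser ball
    gives additivity, hence the value of mu on balls (mu_Xball); taking chi
    gives the first identity (sum_mu_X); taking chi on the multiples of p and
    substituting x = p y, with [p y]_q = [p]_q [y]_{q^p}, gives the second
    (sum_mu_pX). The approximating sums turn out to be independent of N, so the
    outer limits are trivial.

    The case d = 1, N = 0 of the key fact says that the n-th q-Bernoulli number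
    of weight alpha in base Q is the limit of the truncated moments
    1/[p^N]_Q sum_{x < p^N} [x]_{Q^alpha}^n Q^x (qmoment_cvg). Since
    [x + 1] = 1 + Q^alpha [x], the recursion applied to the truncated moments
    telescopes to a single boundary term (rec_lhs_qmoment), which converges to
    the prescribed right-hand side. The recursion is a triangular linear system,
    both for Q = 1 and for Q <> 1 (rec_lhs_triangular), so this gives at once
    the convergence of the moments, the existence of a solution and its
    uniqueness. The general case follows by writing x = a + M j and expanding
    [a + M j]_{q^alpha}
      = [M]_{q^alpha} ([a/M]_{q^(alpha M)} + q^(alpha a) [j]_{q^(alpha M)}).

    For the dilated distribution, an element beta of X^* maps a ball of level N
    onto a ball of level N (Xmul_Xball), although it need not be invertible
    modulo d. If it is, the sums are reindexed by the bijection x |-> beta x. If it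
    is not, the factor chi (1/beta) is 0, and the sums vanish because chi is
    primitive (sum_chi_dilate). The first two identities then apply to the base
    q^(1/beta), which is again admissible (qbase_Zpow). *)

(** * Ultrametric absolute values *)

(** Bernoulli's inequality in the form c^n (1 + n (1 - c)) <= 1. *)
Lemma expr_vanish (R : realType) (c e : R) : 0 <= c -> c < 1 -> 0 < e ->
  exists N : nat, forall n, (N <= n)%N -> c ^+ n < e.
Proof.
move=> c0 c1 e0.
have bern n : c ^+ n * (1 + n%:R * (1 - c)) <= 1.
  elim: n => [|n]; first by rewrite expr0 mul0r addr0 mulr1.
  apply: le_trans; rewrite exprSr -mulrA ler_wpM2l ?exprn_ge0 //.
  rewrite -[n.+1%:R]natr1.
  have n0 : 0 <= n%:R :> R by [].
  rewrite -subr_ge0; set m := n%:R in n0 *.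
  have -> : 1 + m * (1 - c) - c * (1 + (m + 1) * (1 - c))
            = (1 - c) ^+ 2 * (1 + m) by ring.
  by rewrite mulr_ge0 ?sqr_ge0 // addr_ge0.
have h0 : 0 < e * (1 - c) by rewrite mulr_gt0 // subr_gt0.
exists (Num.bound (e * (1 - c))^-1) => n Nn.
have big : (e * (1 - c))^-1 < n%:R.
  apply: lt_le_trans (archi_boundP _) _; first by rewrite invr_ge0 ltW.
  by rewrite ler_nat.
have {}big : 1 < e * (1 - c) * n%:R by rewrite mulrC -ltr_pdivrMr ?mul1r.
have n0 : 0 <= n%:R :> R by [].
have s0 : 0 < 1 + n%:R * (1 - c) by nra.
rewrite -(ltr_pM2r s0); apply: le_lt_trans (bern n) _; nra.
Qed.

Section Ultrametric.
Context (R : realType) (K : fieldType) (nv : K -> R) (p : nat).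
Context (p_prime : prime p) (Cp : is_Cp nv p).

Lemma nv_ge0 x : 0 <= nv x. Proof. exact: Cp_ge0 Cp x. Qed.
Hint Resolve nv_ge0 : core.

Lemma nvM x y : nv (x * y) = nv x * nv y. Proof. exact: Cp_mul Cp x y. Qed.

Lemma nv0 : nv 0 = 0. Proof. exact/(Cp_eq0 Cp). Qed.

Lemma nv_neq0 x : x != 0 -> nv x != 0.
Proof. by apply: contra => /eqP /(Cp_eq0 Cp) ->. Qed.

Lemma nv1 : nv 1 = 1.
Proof.
by apply: (mulfI (nv_neq0 (oner_neq0 K))); rewrite -nvM !mulr1.
Qed.

Lemma nvX x n : nv (x ^+ n) = nv x ^+ n.
Proof. by elim: n => [|n IH]; rewrite ?expr0 ?nv1 // !exprS nvM IH. Qed.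

Lemma nvN x : nv (- x) = nv x.
Proof.
rewrite -mulN1r nvM; suff -> : nv (- 1) = 1 by rewrite mul1r.
by apply/eqP; rewrite -sqrp_eq1 // -nvX sqrrN expr1n nv1.
Qed.

Lemma nvB x y : nv (x - y) = nv (y - x).
Proof. by rewrite -nvN opprB. Qed.

Lemma nvD_le x y e : nv x <= e -> nv y <= e -> nv (x + y) <= e.
Proof. by move=> xe ye; apply: le_trans (Cp_ultra Cp x y) _; rewrite ge_max xe. Qed.

Lemma nvD_lt x y e : nv x < e -> nv y < e -> nv (x + y) < e.
Proof. by move=> xe ye; apply: le_lt_trans (Cp_ultra Cp x y) _; rewrite gt_max xe. Qed.

Lemma nv_sum_le n (F : 'I_n -> K) e :
  0 <= e -> (forall i, nv (F i) <= e) -> nv (\sum_i F i) <= e.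
Proof.
move=> e0 Fe; elim/big_ind: _ => //; first by rewrite nv0.
by move=> x y; exact: nvD_le.
Qed.

Lemma nv_nat_le1 n : nv n%:R <= 1.
Proof.
rewrite -[n]card_ord -sumr_const; apply: nv_sum_le => // i.
by rewrite nv1.
Qed.

Lemma nv_p_lt1 : nv p%:R < 1.
Proof. by rewrite (Cp_norm_p Cp) invf_lt1 ?ltr1n ?prime_gt1 // ltr0n prime_gt0. Qed.

(** By Bezout, u n - v p = 1 for some u, v; if n were small, the left-hand side
    would be small too. *)
Lemma nv_nat_coprime n : coprime n p -> nv n%:R = 1.
Proof.
move=> cop; have p1 := prime_gt1 p_prime.
have n0 : (0 < n)%N by case: n cop => //; rewrite /coprime gcd0n; lia.
apply/eqP; rewrite eq_le nv_nat_le1 leNgt; apply/negP => nlt.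
case: (egcdnP p n0) => u v E _.
have : nv (u%:R * n%:R - v%:R * p%:R) < 1.
  apply: nvD_lt; rewrite ?nvN nvM mulrC; apply: le_lt_trans (ler_piMr _ (nv_nat_le1 _)) _ => //.
  exact: nv_p_lt1.
by rewrite -!natrM E (eqP cop) natrD addrC addKr nv1 ltxx.
Qed.

(** If n = m p^a with m prime to p, then nv n = p^-a. *)
Lemma natr_neq0 n : (0 < n)%N -> n%:R != 0 :> K.
Proof.
move=> n0; have [m pm ->] := pfactor_coprime p_prime n0.
rewrite natrM natrX mulf_neq0 ?expf_neq0 //.
  apply: contra_eq_neq (nv_nat_coprime (etrans (coprime_sym _ _) pm)) => ->.
  by rewrite nv0 eq_sym oner_neq0.
apply: contra_eq_neq (Cp_norm_p Cp) => ->.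
by rewrite nv0 eq_sym invr_neq0 // pnatr_eq0 -lt0n prime_gt0.
Qed.

(** * Convergence *)

Lemma pcvg_unique u l m : pcvg nv u l -> pcvg nv u m -> l = m.
Proof.
move=> ul um; apply/eqP; rewrite -subr_eq0; apply/eqP/(Cp_eq0 Cp).
apply/eqP; rewrite eq_le nv_ge0 andbT leNgt; apply/negP => e0.
have [N HN] := ul _ e0; have [M HM] := um _ e0.
suff : nv (l - m) < nv (l - m) by rewrite ltxx.
rewrite -{1}(subrKA (u (maxn N M))) addrC; apply: nvD_lt.
  exact/HM/leq_maxr.
by rewrite nvB; exact/HN/leq_maxl.
Qed.

Lemma plimP u l : pcvg nv u l -> plim nv u = l.
Proof.
move=> ul; apply: (pcvg_unique _ ul).
by rewrite /plim; case: xgetP => [x -> //|/(_ l)].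
Qed.

Lemma pcvg_plim u : (exists l, pcvg nv u l) -> pcvg nv u (plim nv u).
Proof. by case=> l ul; rewrite (plimP ul). Qed.

Lemma pcvg_near u v l N :
  (forall n, (N <= n)%N -> u n = v n) -> pcvg nv u l -> pcvg nv v l.
Proof.
move=> uv ul e e0; have [M HM] := ul e e0; exists (maxn N M) => n.
by rewrite geq_max => /andP[Nn Mn]; rewrite -uv // HM.
Qed.

Lemma pcvg_eq u v l : (forall n, u n = v n) -> pcvg nv u l -> pcvg nv v l.
Proof. by move=> uv; apply: (@pcvg_near _ _ _ 0). Qed.

Lemma pcvg_cst l : pcvg nv (fun=> l) l.
Proof. by move=> e e0; exists 0%N => n _; rewrite subrr nv0. Qed.

Lemma pcvg_shift m u l : pcvg nv (fun n => u (m + n)%N) l <-> pcvg nv u l.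
Proof.
split=> ul e e0; have [N HN] := ul e e0.
  exists (m + N)%N => n mn; rewrite -(subnKC (leq_trans (leq_addr _ _) mn)).
  by apply: HN; lia.
by exists N => n Nn; apply: HN; lia.
Qed.

Lemma pcvgD u v l m : pcvg nv u l -> pcvg nv v m ->
  pcvg nv (fun n => u n + v n) (l + m).
Proof.
move=> ul vm e e0; have [N HN] := ul e e0; have [M HM] := vm e e0.
exists (maxn N M) => n; rewrite geq_max => /andP[Nn Mn].
rewrite opprD addrACA; apply: nvD_lt; [exact: HN | exact: HM].
Qed.

Lemma pcvg_sum (I : Type) (r : seq I) (P : pred I) (u : I -> nat -> K) (l : I -> K) :
  (forall i, P i -> pcvg nv (u i) (l i)) ->
  pcvg nv (fun n => \sum_(i <- r | P i) u i n) (\sum_(i <- r | P i) l i).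
Proof.
move=> ul; elim: r => [|i r IH].
  by rewrite big_nil; apply: pcvg_eq (pcvg_cst 0) => n; rewrite big_nil.
rewrite big_cons; case: ifP => Pi.
  by apply: pcvg_eq (pcvgD (ul i Pi) IH) => n; rewrite big_cons Pi.
by apply: pcvg_eq IH => n; rewrite big_cons Pi.
Qed.

Lemma pcvg0M u v : (forall n, nv (v n) <= 1) -> pcvg nv u 0 ->
  pcvg nv (fun n => u n * v n) 0.
Proof.
move=> v1 u0 e e0; have [N HN] := u0 e e0; exists N => n /HN.
rewrite !subr0 nvM; apply: le_lt_trans; exact: ler_piMr.
Qed.

Lemma pcvgZ a u l : pcvg nv u l -> pcvg nv (fun n => a * u n) (a * l).
Proof.
move=> ul e e0; have [|N HN] := ul (e / (nv a + 1)).
  by rewrite divr_gt0 // ltr_wpDl.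
exists N => n /HN; rewrite -mulrBr nvM ltr_pdivlMr ?ltr_wpDl //.
by apply: le_lt_trans; rewrite mulrC ler_wpM2l // lerDl.
Qed.

Lemma pcvgM u v l m : pcvg nv u l -> pcvg nv v m ->
  pcvg nv (fun n => u n * v n) (l * m).
Proof.
move=> ul vm.
have E n : u n * v n = l * v n + (m * (u n - l) + (u n - l) * (v n - m)) by ring.
have -> : l * m = l * m + (m * (l - l) + 0) by ring.
apply: (pcvg_eq (fun n => esym (E n))).
have u0 : pcvg nv (fun n => u n - l) (l - l) by apply: pcvgD => //; exact: pcvg_cst.
apply: pcvgD; [exact: pcvgZ | apply: pcvgD; first exact: pcvgZ].
have [N HN] := vm 1 ltr01.
rewrite subrr in u0.
(* nv (v n - m) <= 1 is only known from N on. *)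
pose v' n := if (N <= n)%N then v n - m else 0.
apply: (@pcvg_near (fun n => (u n - l) * v' n) _ _ N) => [n Nn|].
  by rewrite /v' Nn.
apply: pcvg0M u0 => n; rewrite /v'.
by case: ifP => [/HN/ltW //|_]; rewrite nv0.
Qed.

Lemma pcvgX u l k : pcvg nv u l -> pcvg nv (fun n => u n ^+ k) (l ^+ k).
Proof.
move=> ul; elim: k => [|k IH]; first exact: pcvg_cst.
by rewrite exprS; apply: pcvg_eq (pcvgM ul IH) => n; rewrite exprS.
Qed.

Lemma pcvg_dom u l (c : R) : 0 <= c -> c < 1 ->
  (forall n, nv (u n - l) <= c ^+ n) -> pcvg nv u l.
Proof.
move=> c0 c1 uc e e0; have [N HN] := expr_vanish c0 c1 e0.
by exists N => n /HN; apply: le_lt_trans.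
Qed.

(** * q-integers *)

(** The geometric sum makes sense at Q = 1 as well, so that from here on few
    arguments have to separate that value. *)
Lemma qintE (Q : K) n : qint Q n = \sum_(i < n) Q ^+ i.
Proof.
rewrite /qint /qnum; case: eqP => [->|/eqP Q1].
  by under eq_bigr do rewrite expr1n; rewrite sumr_const card_ord.
have Q1' : 1 - Q != 0 by rewrite subr_eq0 eq_sym.
by apply: (canLR (mulfK Q1')); rewrite -opprB subrX1 -mulNr opprB mulrC.
Qed.

Lemma subr1X (Q : K) n : 1 - Q ^+ n = (1 - Q) * qint Q n.
Proof. by rewrite qintE -opprB subrX1 -mulNr opprB. Qed.

Lemma qint_addn (Q : K) m n : qint Q (m + n) = qint Q m + Q ^+ m * qint Q n.
Proof.
rewrite !qintE big_split_ord /= mulr_sumr; congr (_ + _).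
by apply: eq_bigr => i _; rewrite exprD.
Qed.

Lemma qint0 (Q : K) : qint Q 0 = 0. Proof. by rewrite qintE big_ord0. Qed.

Lemma qint1 (Q : K) : qint Q 1 = 1.
Proof. by rewrite qintE big_ord1. Qed.

Lemma qint_muln (Q : K) m n : qint Q (m * n) = qint Q m * qint (Q ^+ m) n.
Proof.
elim: n => [|n IH]; first by rewrite muln0 !qint0 mulr0.
rewrite mulnSr -[n.+1]addn1 !qint_addn IH qint1 mulr1 mulrDr -exprM.
by rewrite [_ ^+ (m * n) * _]mulrC.
Qed.

Lemma qint_succ (Q : K) n : qint Q n.+1 = 1 + Q * qint Q n.
Proof. by rewrite -add1n qint_addn qint1. Qed.

Lemma nv_base Q : nv (1 - Q) < 1 -> nv Q <= 1.
Proof.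
by move=> Q1; rewrite -[Q](subKr 1) nvD_le ?nv1 // nvN ltW.
Qed.

Lemma nv_exp_base Q n : nv (1 - Q) < 1 -> nv (Q ^+ n) <= 1.
Proof. by move=> Q1; rewrite nvX exprn_ile1 // nv_base. Qed.

Lemma nv_qint_le1 Q n : nv (1 - Q) < 1 -> nv (qint Q n) <= 1.
Proof.
by move=> Q1; rewrite qintE; apply: nv_sum_le => // i; exact: nv_exp_base.
Qed.

Lemma nv_subr1X Q n : nv (1 - Q) < 1 -> nv (1 - Q ^+ n) <= nv (1 - Q).
Proof. by move=> Q1; rewrite subr1X nvM ler_piMr // nv_qint_le1. Qed.

Lemma nv_subr1X_lt1 Q n : nv (1 - Q) < 1 -> nv (1 - Q ^+ n) < 1.
Proof. by move=> Q1; apply: le_lt_trans (nv_subr1X n Q1) Q1. Qed.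

Lemma nv_qint_nat Q n : nv (1 - Q) < 1 -> nv (qint Q n - n%:R) <= nv (1 - Q).
Proof.
move=> Q1; rewrite qintE -[n in n%:R]card_ord -sumr_const -sumrB.
by apply: nv_sum_le => // i; rewrite nvB nv_subr1X.
Qed.

(** Passing from Q^m to Q^(mp) multiplies 1 - Q^m by [p]_{Q^m}, which lies within
    nv (1 - Q) of p; the ratio is thus at most this number, which is < 1. *)
Definition contraction Q : R := Num.max (nv p%:R) (nv (1 - Q)).

Lemma contraction_ge0 Q : 0 <= contraction Q.
Proof. by rewrite /contraction le_max nv_ge0. Qed.

Lemma contraction_lt1 Q : nv (1 - Q) < 1 -> contraction Q < 1.
Proof. by move=> Q1; rewrite gt_max nv_p_lt1. Qed.

Lemma nv_qint_expp Q N : nv (1 - Q) < 1 ->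
  nv (qint Q (p ^ N)) <= contraction Q ^+ N.
Proof.
move=> Q1; elim: N => [|N IH].
  by rewrite expn0 expr0 nv_qint_le1.
rewrite expnSr qint_muln nvM exprSr ler_pM //.
rewrite -[qint _ p](subrK p%:R); apply: nvD_le; last by rewrite le_max lexx.
apply: le_trans (nv_qint_nat _ (nv_subr1X_lt1 _ Q1)) _.
by apply: le_trans (nv_subr1X _ Q1) _; rewrite le_max lexx orbT.
Qed.

(** Uniform p-adic continuity of the exponential n |-> Q^n. *)
Lemma nv_exp_congr Q m n N : nv (1 - Q) < 1 -> m = n %[mod p ^ N] ->
  nv (Q ^+ m - Q ^+ n) <= contraction Q ^+ N.
Proof.
move=> Q1; wlog nm : m n / (n <= m)%N => [H|/eqP].
  by case/orP: (leq_total m n) => h ?; [rewrite nvB|]; apply: H.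
rewrite eqn_mod_dvd // => /dvdnP[t mE].
rewrite -(subnKC nm) mE mulnC exprD exprM -[X in _ - X]mulr1 -mulrBr nvM nvB.
apply: le_trans (ler_piMl (nv_ge0 _) (nv_exp_base _ Q1)) _.
apply: le_trans (nv_subr1X _ (nv_subr1X_lt1 _ Q1)) _.
rewrite subr1X nvM; apply: le_trans (nv_qint_expp N Q1).
by rewrite ler_piMl // ltW.
Qed.

Lemma qint_expp_cvg Q : nv (1 - Q) < 1 -> pcvg nv (fun N => qint Q (p ^ N)) 0.
Proof.
move=> Q1; apply: pcvg_dom (contraction_ge0 Q) (contraction_lt1 Q1) _ => N.
by rewrite subr0 nv_qint_expp.
Qed.

Lemma exp_expp_cvg Q : nv (1 - Q) < 1 -> pcvg nv (fun N => Q ^+ (p ^ N)) 1.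
Proof.
move=> Q1; apply: pcvg_dom (contraction_ge0 Q) (contraction_lt1 Q1) _ => N.
by rewrite -[1](expr0 Q) nv_exp_congr // modnn mod0n.
Qed.

Lemma qint_nat_cvg Q n : nv (1 - Q) < 1 ->
  pcvg nv (fun N => qint (Q ^+ (p ^ N)) n) n%:R.
Proof.
move=> Q1; apply: pcvg_dom (contraction_ge0 Q) (contraction_lt1 Q1) _ => N.
apply: le_trans (nv_qint_nat _ (nv_subr1X_lt1 _ Q1)) _.
by rewrite -[1](expr0 Q) nv_exp_congr // modnn mod0n.
Qed.

(** The bases for which all q-integers of positive index are invertible: Q = 1,
    and the Q <> 1 close to 1 that are not roots of unity. *)
Definition qbase Q : Prop :=
  nv (1 - Q) < 1 /\ forall m, (0 < m)%N -> qint Q m != 0.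

Lemma qbaseX Q m : (0 < m)%N -> qbase Q -> qbase (Q ^+ m).
Proof.
move=> m0 [Q1 Qn]; split=> [|n n0]; first exact: nv_subr1X_lt1.
have := Qn (m * n)%N; rewrite muln_gt0 m0 n0 qint_muln mulf_eq0 negb_or.
by case/(_ isT)/andP.
Qed.

Lemma qbase_neq1 Q m : (0 < m)%N -> qbase Q -> Q != 1 -> Q ^+ m != 1.
Proof.
move=> m0 [_ Qn] Q1; rewrite eq_sym -subr_eq0 subr1X mulf_neq0 ?Qn //.
by rewrite subr_eq0 eq_sym.
Qed.

(** A root of unity close to 1 has p-power order: if n is prime to p then [n]_r
    is close to n, hence non-zero, for every r close to 1. It is therefore enough
    to exclude the orders d p^N. *)
Lemma qbase_level Q d : (0 < d)%N -> nv (1 - Q) < 1 ->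
  (forall N, qint Q (d * p ^ N) != 0) -> qbase Q.
Proof.
move=> d0 Q1 Qd; split=> // m m0; have [m' pm' ->] := pfactor_coprime p_prime m0.
set a := logn p m; set M := (m' * p ^ a)%N.
have : qint Q (M * d) != 0.
  rewrite (_ : M * d = d * p ^ a * m')%N; last by rewrite /M; lia.
  rewrite qint_muln mulf_neq0 //.
  have := nv_qint_nat m' (nv_subr1X_lt1 (d * p ^ a) Q1).
  apply: contraTneq => ->; rewrite sub0r nvN -ltNge.
  by rewrite nv_nat_coprime 1?coprime_sym // nv_subr1X_lt1.
by rewrite qint_muln mulf_eq0 negb_or => /andP[].
Qed.

(** * q-Bernoulli numbers as limits of moments *)

Section Moments.
Context (alpha : nat) (alpha_gt0 : (0 < alpha)%N).

Definition rec_lhs (Q : K) (b : nat -> K) (n : nat) : K :=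
  Q * (\sum_(l < n.+1) (Q ^+ alpha) ^+ l * b l *+ 'C(n, l)) - b n.

(** The unknown of index n is determined by the n-th equation if Q <> 1, its
    coefficient being Q^(alpha n + 1) - 1. At Q = 1 that coefficient vanishes and
    the unknown is read off from equation n + 1, with coefficient n + 1. The
    index e of the equation is hidden here so that both cases can be treated
    together. *)
Lemma rec_lhs_triangular Q n : qbase Q -> (0 < n)%N ->
  exists e (c : nat -> K), [/\ (0 < e)%N, c n != 0 &
    forall b, rec_lhs Q b e = \sum_(l < n.+1) c l * b l].
Proof.
move=> Qb n0; have [Q1|Q1] := eqVneq Q 1.
  exists n.+1, (fun l => 'C(n.+1, l)%:R); split=> // [|b].
    by rewrite binSn natr_neq0.
  rewrite /rec_lhs Q1 mul1r big_ord_recr /= binn mulr1n !expr1n mul1r addrK.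
  by apply: eq_bigr => l _; rewrite !expr1n mul1r mulr_natl.
exists n, (fun l => Q * (Q ^+ alpha) ^+ l *+ 'C(n, l) - (l == n)%:R).
split=> // [|b].
  rewrite binn mulr1n eqxx -exprM -exprS subr_eq0.
  exact: qbase_neq1 Qb Q1.
rewrite /rec_lhs mulr_sumr -[b n in LHS]mul1r.
under [in RHS]eq_bigr do rewrite mulrBl.
rewrite sumrB; congr (_ - _).
  by apply: eq_bigr => l _; rewrite mulrnAr mulrnAl mulrA.
rewrite big_ord_recr /= eqxx big1 ?add0r // => l _.
by rewrite ltn_eqF ?mul0r.
Qed.

Definition qmoment (Q : K) (n N : nat) : K :=
  (qint Q (p ^ N))^-1 * \sum_(x < p ^ N) qint (Q ^+ alpha) x ^+ n * Q ^+ x.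

(** As [x + 1]_{Q^alpha} = 1 + Q^alpha [x]_{Q^alpha}, the binomial expansion
    turns the left-hand side into a sum of f (x + 1) - f x, where
    f x = [x]_{Q^alpha}^n Q^x vanishes at 0. *)
Lemma rec_lhs_qmoment Q n N : (0 < n)%N ->
  rec_lhs Q (qmoment Q ^~ N) n
  = Q ^+ (p ^ N) * (qint (Q ^+ alpha) (p ^ N) / qint Q (p ^ N))
    * qint (Q ^+ alpha) (p ^ N) ^+ n.-1.
Proof.
move=> n0; set M := (p ^ N)%N; set f := fun x => qint (Q ^+ alpha) x ^+ n * Q ^+ x.
transitivity ((qint Q M)^-1 * \sum_(x < M) (f x.+1 - f x)).
  rewrite /rec_lhs sumrB mulrBr; congr (_ - _).
  under eq_bigr => l _ do rewrite mulrCA -mulrnAr mulr_sumr -sumrMnl.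
  rewrite -mulr_sumr exchange_big mulrCA /=; congr (_ * _).
  rewrite mulr_sumr; apply: eq_bigr => x _.
  rewrite /f qint_succ exprDn mulr_suml mulr_sumr.
  apply: eq_bigr => l _.
  rewrite expr1n mul1r exprMn exprS -mulr_natl -[in RHS]mulr_natl; ring.
rewrite -(big_mkord xpredT (fun x => f x.+1 - f x)).
rewrite telescope_sumr // /f qint0 expr0n gtn_eqF // mul0r subr0.
by case: n n0 {f} => // n _; rewrite exprS /=; ring.
Qed.

Lemma rec_lhs_qmoment_cvg Q n : qbase Q -> (0 < n)%N ->
  pcvg nv (fun N => rec_lhs Q (qmoment Q ^~ N) n)
    (if n == 1%N then alpha%:R / qint Q alpha else 0).
Proof.
move=> [Q1 Qn] n0.
have pN N : (0 < p ^ N)%N by rewrite expn_gt0 prime_gt0.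
have -> : (if n == 1%N then alpha%:R / qint Q alpha else 0)
    = 1 * (alpha%:R / qint Q alpha) * 0 ^+ n.-1.
  by case: n n0 => // -[|n] _ /=; rewrite ?expr0 ?mul1r ?mulr1 // exprS !mul0r mulr0.
apply: (pcvg_eq (fun N => esym (rec_lhs_qmoment Q N n0))).
apply: pcvgM; last exact/pcvgX/qint_expp_cvg/nv_subr1X_lt1.
apply: pcvgM; first exact: exp_expp_cvg.
(* [alpha p^N]_Q is both [alpha]_Q [p^N]_{Q^alpha} and [p^N]_Q [alpha]_{Q^(p^N)}. *)
have E N : (qint Q alpha)^-1 * qint (Q ^+ (p ^ N)) alpha
    = qint (Q ^+ alpha) (p ^ N) / qint Q (p ^ N).
  apply: (mulfI (Qn _ alpha_gt0)); rewrite mulVKf ?Qn // mulrA -qint_muln mulnC.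
  by rewrite qint_muln mulrC mulKf ?Qn.
rewrite [_ / _]mulrC; apply: (pcvg_eq E).
exact/pcvgZ/qint_nat_cvg.
Qed.

Lemma qmoment0 Q N : qbase Q -> qmoment Q 0 N = 1.
Proof.
move=> [_ Qn]; rewrite /qmoment.
under eq_bigr do rewrite expr0 mul1r.
by rewrite -qintE mulVf // Qn // expn_gt0 prime_gt0.
Qed.

Lemma solve_last (c b : nat -> K) n : c n != 0 ->
  b n = (c n)^-1 * (\sum_(l < n.+1) c l * b l - \sum_(l < n) c l * b l).
Proof. by move=> cn; rewrite big_ord_recr /= [_ + c n * _]addrC addrK mulKf. Qed.

Lemma qmoment_cvg_ex Q n : qbase Q -> exists l, pcvg nv (qmoment Q n) l.
Proof.
move=> Qb; elim/ltn_ind: n => -[_|n IH].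
  exists 1; apply: (pcvg_eq _ (pcvg_cst 1)) => N; exact/esym/qmoment0.
have [e [c [e0 cn Ec]]] := rec_lhs_triangular Qb (ltn0Sn n).
exists ((c n.+1)^-1 * ((if e == 1%N then alpha%:R / qint Q alpha else 0)
   + - 1 * \sum_(l < n.+1) c l * plim nv (qmoment Q l))).
apply: (@pcvg_eq (fun N => (c n.+1)^-1 * (rec_lhs Q (qmoment Q ^~ N) e
   + - 1 * \sum_(l < n.+1) c l * qmoment Q l N))) => [N|].
  by rewrite [RHS](solve_last (qmoment Q ^~ N) cn) Ec mulN1r.
apply/pcvgZ/pcvgD; first exact: rec_lhs_qmoment_cvg.
by apply/pcvgZ/pcvg_sum => l _; apply/pcvgZ/pcvg_plim/IH.
Qed.

Lemma qbern_rec_limit Q : qbase Q ->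
  qbern_rec alpha Q (fun n => plim nv (qmoment Q n)).
Proof.
move=> Qb; split=> [|n n0].
  by apply: plimP; apply: (pcvg_eq _ (pcvg_cst 1)) => N; exact/esym/qmoment0.
apply: pcvg_unique (rec_lhs_qmoment_cvg Qb n0).
apply: (@pcvg_eq (fun N => Q * (\sum_(l < n.+1)
   ((Q ^+ alpha) ^+ l *+ 'C(n, l)) * qmoment Q l N) + - 1 * qmoment Q n N)) => [N|].
  by rewrite mulN1r; congr (_ * _ - _); apply: eq_bigr => l _; rewrite mulrnAl.
rewrite -[X in pcvg _ _ (_ + X)]mulN1r; apply: pcvgD; last exact/pcvgZ/pcvg_plim/qmoment_cvg_ex.
apply: pcvgZ; rewrite (eq_bigr (fun l : 'I__ =>
  ((Q ^+ alpha) ^+ l *+ 'C(n, l)) * plim nv (qmoment Q l))); last first.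
  by move=> l _; rewrite mulrnAl.
by apply: pcvg_sum => l _; apply/pcvgZ/pcvg_plim/qmoment_cvg_ex.
Qed.

Lemma qbern_rec_unique Q b b' n : qbase Q ->
  qbern_rec alpha Q b -> qbern_rec alpha Q b' -> b n = b' n.
Proof.
move=> Qb [b0 br] [b'0 b'r]; elim/ltn_ind: n => -[_|n IH].
  by rewrite b0 b'0.
have [e [c [e0 cn Ec]]] := rec_lhs_triangular Qb (ltn0Sn n).
rewrite (solve_last b cn) (solve_last b' cn) -!Ec /rec_lhs br // b'r //.
by congr (_ * (_ - _)); apply: eq_bigr => l _; rewrite IH.
Qed.

Lemma qmoment_cvg Q n : qbase Q -> pcvg nv (qmoment Q n) (qbern alpha Q n).
Proof.
move=> Qb; have Hl := qbern_rec_limit Qb.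
rewrite (_ : qbern alpha Q n = plim nv (qmoment Q n)).
  exact/pcvg_plim/qmoment_cvg_ex.
apply: (qbern_rec_unique _ Qb _ Hl).
by rewrite /qbern; case: xgetP => [b -> //|/(_ _ Hl)].
Qed.


(** * The distribution as an integral *)

Section Distribution.
Context (d : nat) (d_gt0 : (0 < d)%N) (k : nat).

Lemma level_gt0 N : (0 < d * p ^ N)%N.
Proof. by rewrite muln_gt0 d_gt0 expn_gt0 prime_gt0. Qed.
Hint Resolve level_gt0 : core.

Lemma residue_mod (x : Xd p d) m n : (m <= n)%N -> (x n %% (d * p ^ m) = x m)%N.
Proof.
move/subnKC <-; elim: (n - m)%N => [|j IH].
  by rewrite addn0 -(residue_compat x m) modn_mod.
rewrite addnS -{}IH -(residue_compat x (m + j)) modn_dvdm //.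
by rewrite dvdn_pmul2l // dvdn_exp2l // leq_addr.
Qed.

Lemma residue_small (x : Xd p d) N : (x N %% (d * p ^ N) = x N)%N.
Proof. exact: residue_mod. Qed.

Lemma sum_residue_class (F : nat -> K) M n a : (a < M)%N ->
  \sum_(x < M * n | (x %% M == a)%N) F x = \sum_(j < n) F (a + M * j)%N.
Proof.
move=> aM; elim: n => [|n IH].
  by rewrite [RHS]big_ord0 big1 // => -[x]; rewrite muln0.
rewrite big_ord_recr /= -IH mulnSr big_split_ord /=; congr (_ + _).
rewrite (big_pred1 (Ordinal aM)) /= => [|i]; first by rewrite addnC.
by rewrite /= -val_eqE /= mulnC modnMDl modn_small.
Qed.

(** [M]_r [a/M]_{r^M} = [a]_r, where (r^M)^(a/M) is read as r^a. *)
Lemma qint_qnum r M a : (0 < M)%N -> qbase r ->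
  qint r M * qnum (r ^+ M) (r ^+ a) (a%:R / M%:R) = qint r a.
Proof.
move=> M0 rb; rewrite /qint /qnum; have [r1|r1] := eqVneq r 1.
  by rewrite r1 expr1n eqxx mulrC divfK ?natr_neq0.
rewrite (negbTE (qbase_neq1 M0 rb r1)) mulrC mulrA divfK //.
by rewrite subr_eq0 eq_sym qbase_neq1.
Qed.

(** The sequence whose limit is volkenborn. *)
Definition vsum (q : K) (f : nat -> K) (N : nat) : K :=
  (qint q (d * p ^ N))^-1 * \sum_(x < d * p ^ N) f x * q ^+ x.

(** Only the x = a + M j with j < p^n contribute at level N + n. There
    [a + M j]_{q^alpha} is [M]_{q^alpha} times an affine function of
    [j]_{q^(M alpha)}, so the binomial formula turns the sum into a combination of
    the moments in base q^M, and the limit into the q-Bernoulli polynomial. *)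
Lemma mu_ball_cvg q N a : qbase q -> (a < d * p ^ N)%N ->
  pcvg nv (vsum q (fun x => (x %% (d * p ^ N) == a)%N%:R * qint (q ^+ alpha) x ^+ k))
    (mu_ball p d alpha k q N a).
Proof.
move=> qb aM; apply: (pcvg_shift N _ _).1; rewrite /mu_ball /qbern_poly /=.
set M := (d * p ^ N)%N in aM *; set Q := q ^+ M.
set A := qnum _ _ _.
have M0 : (0 < M)%N := level_gt0 N.
have Qb : qbase Q := qbaseX M0 qb.
have numE j : qint (q ^+ alpha) (a + M * j)
    = qint (q ^+ alpha) M * (A + (q ^+ a) ^+ alpha * qint (Q ^+ alpha) j).
  rewrite qint_addn qint_muln /A [_ ^+ a ^+ alpha]exprAC [Q ^+ _]exprAC.
  rewrite mulrDr qint_qnum //; last exact: qbaseX.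
  by congr (_ + _); ring.
have levelE n : (d * p ^ (N + n) = M * p ^ n)%N by rewrite expnD mulnA.
apply: (@pcvg_eq (fun n => qint (q ^+ alpha) M ^+ k / qint q M * q ^+ a *
   \sum_(l < k.+1) (A ^+ (k - l) * q ^+ a ^+ (alpha * l) *+ 'C(k, l)) * qmoment Q l n)).
  move=> n; rewrite /vsum levelE qint_muln.
  under [in RHS]eq_bigr do rewrite -mulrA mulr_natl mulrb.
  rewrite -big_mkcond /= (sum_residue_class (fun x => qint (q ^+ alpha) x ^+ k * q ^+ x)) //.
  under [in RHS]eq_bigr => j _ do
    rewrite numE exprMn exprD exprM -/Q mulrACA exprDn mulr_suml.
  rewrite -mulr_sumr exchange_big /= invfM.
  under [in LHS]eq_bigr => l _ do rewrite /qmoment mulrCA.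
  rewrite -mulr_sumr !mulrA; set s := \sum_(_ < _) _; set t := \sum_(_ < _) _.
  have -> : s = t; last by rewrite -/Q; ring.
  apply: eq_bigr => l _; rewrite mulr_sumr; apply: eq_bigr => j _.
  by rewrite exprMn exprM !mulrnAl !mulrA.
apply: pcvgZ; under [X in pcvg _ _ X]eq_bigr => l _ do rewrite -mulrnAl.
by apply: pcvg_sum => l _; apply/pcvgZ/qmoment_cvg.
Qed.

Lemma mu_ball_sum_cvg q N (F : nat -> K) : qbase q ->
  (forall x, F (x %% (d * p ^ N))%N = F x) ->
  pcvg nv (vsum q (fun x => F x * qint (q ^+ alpha) x ^+ k))
    (\sum_(a < d * p ^ N) F a * mu_ball p d alpha k q N a).
Proof.
move=> qb Fper; set M := (d * p ^ N)%N in Fper *.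
apply: (@pcvg_eq (fun n => \sum_(a < M) F a *
   vsum q (fun x => (x %% M == a)%N%:R * qint (q ^+ alpha) x ^+ k) n)) => [n|].
  under eq_bigr => a _ do rewrite /vsum mulrCA mulr_sumr.
  rewrite -mulr_sumr exchange_big /=; congr (_ * _); apply: eq_bigr => x _.
  have xM : (x %% M < M)%N by rewrite ltn_mod level_gt0.
  rewrite (bigD1 (Ordinal xM)) //= eqxx mul1r Fper big1 ?addr0 ?mulrA // => a ax.
  suff -> : (x %% M == a)%N = false by rewrite !mul0r mulr0.
  by apply: contraNF ax => /eqP xa; apply/eqP/val_inj.
by apply: pcvg_sum => a _; apply/pcvgZ/mu_ball_cvg.
Qed.

(** Two balls are nested or disjoint, and a natural number is the centre of any
    ball that contains it. *)
Lemma Xball_subset n N a x : (N <= n)%N ->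
  (Xball (p := p) (d := d) n a `<=` Xball N x) <-> a = x %[mod d * p ^ N].
Proof.
move=> Nn; have dvd : (d * p ^ N %| d * p ^ n)%N.
  by rewrite dvdn_pmul2l // dvdn_exp2l.
split=> [/(_ (Xnat p d a)) H|ax y ya].
  by have := H (modn_mod _ _); rewrite /Xball /= modn_mod.
by rewrite /Xball /= -(residue_mod y Nn) modn_mod -(modn_dvdm _ dvd) ya modn_dvdm.
Qed.

(** The sums defining mu are already constant from level N on: each is the
    integral of the indicator of the ball times [x]_{q^alpha}^k, whatever the
    level used to compute it. This is the distribution relation. *)
Lemma mu_Xball q N x : qbase q ->
  mu nv p d alpha k q (Xball N x) = mu_ball p d alpha k q N (x %% (d * p ^ N)).
Proof.
move=> qb; apply: plimP; apply: (pcvg_near (N := N) _ (pcvg_cst _)) => n Nn.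
have dvd : (d * p ^ N %| d * p ^ n)%N by rewrite dvdn_pmul2l // dvdn_exp2l.
(* Read at level n, the indicator of the ball of level N is a periodic weight. *)
pose F a : K := (a %% (d * p ^ N) == x %% (d * p ^ N))%N%:R.
transitivity (\sum_(a < d * p ^ n) F a * mu_ball p d alpha k q n a).
  apply: pcvg_unique (mu_ball_cvg qb _) _; first by rewrite ltn_mod.
  by apply: mu_ball_sum_cvg => // y; rewrite /F modn_dvdm.
rewrite [RHS]big_mkcond; apply: eq_bigr => a _; rewrite /F.
have -> : (a %% (d * p ^ N) == x %% (d * p ^ N))%N
    = `[< Xball (p := p) (d := d) n a `<=` Xball N x >].
  by apply/eqP/asboolP => /(Xball_subset _ _ Nn).
by case: asboolP; rewrite ?mul1r ?mul0r.
Qed.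

Lemma mu_Xball_periodic q N x : qbase q ->
  mu nv p d alpha k q (Xball N (x %% (d * p ^ N)))
  = mu nv p d alpha k q (Xball N x).
Proof. by move=> qb; rewrite !mu_Xball // modn_mod. Qed.

Section Character.
Context (chi : nat -> K) (chi_cond : dirichlet_of_conductor d chi).

Lemma chi_mod x N : chi (x %% (d * p ^ N))%N = chi x.
Proof. by apply: (dir_period chi_cond); rewrite modn_dvdm // dvdn_mulr. Qed.

Lemma gen_qbern_cvg q : qbase q ->
  pcvg nv (vsum q (fun x => chi x * qint (q ^+ alpha) x ^+ k))
    (gen_qbern nv p d alpha k chi q).
Proof.
move=> qb; apply: pcvg_plim; eexists.
exact: (mu_ball_sum_cvg qb (chi_mod ^~ 0%N)).
Qed.

Lemma sum_mu_X q N : qbase q ->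
  \sum_(x < d * p ^ N) chi x * mu nv p d alpha k q (Xball N x)
  = gen_qbern nv p d alpha k chi q.
Proof.
move=> qb; under eq_bigr => x _ do rewrite mu_Xball // modn_small //.
apply: pcvg_unique (gen_qbern_cvg qb).
exact: (mu_ball_sum_cvg qb (chi_mod ^~ N)).
Qed.

Lemma sum_mu_pX q N : qbase q ->
  \sum_(x < d * p ^ N) chi (p * x)%N * mu nv p d alpha k q (Xball N.+1 (p * x))
  = chi p * (qint (q ^+ alpha) p ^+ k / qint q p)
      * gen_qbern nv p d alpha k chi (q ^+ p).
Proof.
move=> qb; have p0 := prime_gt0 p_prime.
have levelS n : (d * p ^ n.+1 = p * (d * p ^ n))%N by rewrite expnS mulnCA.
pose F x : K := if (p %| x)%N then chi x else 0.
have Fper x : F (x %% (d * p ^ N.+1))%N = F x.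
  by rewrite /F chi_mod /dvdn modn_dvdm // levelS dvdn_mulr.
have sum_pX (G : nat -> K) n : \sum_(x < d * p ^ n.+1) F x * G x
    = \sum_(x < d * p ^ n) chi (p * x)%N * G (p * x)%N.
  rewrite levelS -(sum_residue_class (fun x => chi x * G x) _ p0) [RHS]big_mkcond.
  by apply: eq_bigr => x _; rewrite /F /dvdn; case: eqP; rewrite ?mul0r.
transitivity (\sum_(x < d * p ^ N.+1) F x * mu_ball p d alpha k q N.+1 x).
  rewrite sum_pX; apply: eq_bigr => x _.
  by rewrite mu_Xball // modn_small // levelS ltn_pmul2l.
apply: pcvg_unique (mu_ball_sum_cvg qb Fper) _.
apply: (pcvg_shift 1 _ _).1.
have lim := pcvgZ (chi p * (qint (q ^+ alpha) p ^+ k / qint q p))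
                  (gen_qbern_cvg (qbaseX p0 qb)).
apply: pcvg_eq lim => n; rewrite /vsum add1n.
under [in RHS]eq_bigr do rewrite -mulrA.
rewrite (sum_pX (fun x => qint (q ^+ alpha) x ^+ k * q ^+ x)).
rewrite levelS [qint q (p * _)]qint_muln invfM.
rewrite mulrCA !mulr_sumr; apply: eq_bigr => x _.
rewrite (dir_mul chi_cond) [qint _ (p * x)]qint_muln exprMn exprM.
rewrite [_ ^+ p ^+ alpha]exprAC; ring.
Qed.

End Character.
End Distribution.
End Moments.

(** * Powers with p-adic exponents *)

Lemma Zpow_cvg q (y : Zadic p) : nv (1 - q) < 1 ->
  pcvg nv (fun N => q ^+ y N) (Zpow nv q y).
Proof.
move=> q1; apply/pcvg_plim/(Cp_complete Cp) => e e0.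
have [N HN] := expr_vanish (contraction_ge0 q) (contraction_lt1 q1) e0.
exists N => m n Nm Nn; apply: le_lt_trans (HN N (leqnn N)).
by apply: nv_exp_congr; rewrite // -[(p ^ N)%N]mul1n !residue_mod.
Qed.

Lemma Zpow_near1 q (y : Zadic p) : nv (1 - q) < 1 -> nv (1 - Zpow nv q y) < 1.
Proof.
move=> q1; have [N HN] := Zpow_cvg y q1 ltr01.
rewrite -(subrKA (q ^+ y N)); apply: nvD_lt; last exact: HN.
exact: nv_subr1X_lt1.
Qed.

Lemma pcvg_congr q (u v : nat -> nat) l : nv (1 - q) < 1 ->
  (forall N, u N = v N %[mod p ^ N]) ->
  pcvg nv (fun N => q ^+ u N) l -> pcvg nv (fun N => q ^+ v N) l.
Proof.
move=> q1 uv ul.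
have diff : pcvg nv (fun N => q ^+ v N - q ^+ u N) 0.
  apply: pcvg_dom (contraction_ge0 q) (contraction_lt1 q1) _ => N.
  by rewrite subr0 nv_exp_congr.
by rewrite -[l]add0r; apply: pcvg_eq (pcvgD diff ul) => N; rewrite subrK.
Qed.

Lemma Zpow_muln q (y z : Zadic p) m : nv (1 - q) < 1 ->
  (forall N, z N = m * y N %[mod p ^ N])%N -> Zpow nv q z = Zpow nv q y ^+ m.
Proof.
move=> q1 zy; apply: pcvg_unique (pcvgX m (Zpow_cvg y q1)).
apply: (@pcvg_eq (fun N => q ^+ (m * y N))) => [N|]; first by rewrite mulnC exprM.
exact: pcvg_congr q1 zy (Zpow_cvg z q1).
Qed.

(** If y is a unit of Z_p with inverse b, then q = (q^y)^b, so (q^y)^m = 1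
    forces q^m = 1: raising q^(m y) to the powers b N, which does not increase the
    distance to 1, approaches q^m. *)
Lemma qbase_Zpow q (y : Zadic p) (b : nat -> nat) : qbase q ->
  (forall N, b N * y N = 1 %[mod p ^ N])%N -> qbase (Zpow nv q y).
Proof.
move=> qb by1; have [q1 qn] := qb; set r := Zpow nv q y.
split=> [|m m0]; first exact: Zpow_near1.
have [qE|q_neq1] := eqVneq q 1.
  rewrite (_ : r = q) ?qn //; apply: plimP.
  by apply: pcvg_eq (pcvg_cst q) => N; rewrite qE expr1n.
apply: contra_neq (qbase_neq1 m0 qb q_neq1) => rm0.
have ym1 : pcvg nv (fun N => q ^+ (m * y N)) 1.
  apply: (@pcvg_eq (fun N => (q ^+ y N) ^+ m)) => [N|]; first by rewrite mulnC exprM.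
  suff -> : 1 = r ^+ m by apply/pcvgX/Zpow_cvg.
  by apply/eqP; rewrite -subr_eq0 subr1X rm0 mulr0.
apply: (@pcvg_unique (fun=> q ^+ m)); first exact: pcvg_cst.
have H : pcvg nv (fun N => q ^+ (m * y N * b N)) 1.
  move=> e /ym1[N HN]; exists N => n /HN; apply: le_lt_trans.
  by rewrite nvB [leRHS]nvB exprM nv_subr1X // nv_subr1X_lt1.
apply: pcvg_congr q1 _ H => N.
by rewrite -mulnA [(y N * _)%N]mulnC -modnMmr by1 modnMmr muln1.
Qed.

(** * Dilation by a p-adic unit *)

Section Dilation.
Context (d : nat) (d_gt0 : (0 < d)%N) (cop_pd : coprime p d).

Lemma coprime_level N : coprime d (p ^ N).
Proof. by apply: coprimeXr; rewrite coprime_sym. Qed.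

Lemma eqmod_dvd m D a b : (m %| D)%N -> a = b %[mod D] -> a = b %[mod m].
Proof. by move=> mD ab; rewrite -(modn_dvdm a mD) ab modn_dvdm. Qed.

Lemma eq_mod_level N a b :
  a = b %[mod d] -> a = b %[mod p ^ N] -> a = b %[mod d * p ^ N].
Proof.
move=> ad ap; apply/eqP.
by rewrite (chinese_remainder (coprime_level N)) ad ap !eqxx.
Qed.

Lemma Xd_ext (x y : Xd p d) : (forall N, x N = y N) -> x = y.
Proof.
case: x y => [x xP] [y yP] /= xy; have {xy} E : x = y by apply/funext.
by rewrite E in xP *; congr MkXd; exact: Prop_irrelevance.
Qed.

Lemma residue_mod_p (x : Xd p d) m n : (m <= n)%N -> x n = x m %[mod p ^ m].
Proof. by move=> mn; rewrite -(residue_mod d_gt0 x mn) modn_dvdm ?dvdn_mull. Qed.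

Lemma residue_mod_d (x : Xd p d) n : x n = x 0%N %[mod d].
Proof. by rewrite -(residue_mod d_gt0 x (leq0n n)) muln1 modn_mod. Qed.

Lemma Xstar_coprime (beta : Xd p d) N :
  Xstar beta -> coprime (beta N.+1) p.
Proof.
case=> a /= /andP[_ cop_ap]; rewrite /Xball /= expn1 => ba.
have := residue_mod_p beta (ltn0Sn N); rewrite expn1 => bN.
rewrite -coprime_modl bN -(@modn_dvdm (d * p)) ?dvdn_mull // ba.
by rewrite modn_dvdm ?dvdn_mull // coprime_modl.
Qed.

Lemma inverse_mod (beta : Xd p d) N : coprime (beta 1%N) p ->
  (beta N * Zadic_inv (toZadic beta) N = 1 %[mod p ^ N])%N.
Proof.
move=> cop; rewrite -modnMml -[(p ^ N)%N]mul1n.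
apply: Zadic_invP; first exact: prime_gt0.
by rewrite /= mul1n expn1 coprime_modl.
Qed.

(** For z in the ball around beta x, a preimage is the y that is x modulo d and
    z / beta in Z_p. It is constructed level by level with the Chinese remainder
    theorem, as beta may fail to be invertible modulo d. There beta y = z holds
    because the d-component of z is that of beta x. *)
Lemma Xmul_Xball (beta : Xd p d) N x : coprime (beta 1%N) p ->
  Xmul beta @` Xball N x = Xball N (beta N * x).
Proof.
move=> cop; apply/seteqP; split=> [_ [y yx <-]|z zx].
  by rewrite /Xball /= modn_mod -modnMmr yx modnMmr.
have zxd : z N = (beta N * x)%N %[mod d] := eqmod_dvd (dvdn_mulr _ (dvdnn d)) zx.
have zxp : z N = (beta N * x)%N %[mod p ^ N] := eqmod_dvd (dvdn_mull d (dvdnn _)) zx.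
set bi := Zadic_inv (toZadic beta).
pose yr n := (chinese d (p ^ n) x (bi n * z n) %% (d * p ^ n))%N.
have yr_d n : yr n = x %[mod d].
  by rewrite /yr modn_dvdm ?dvdn_mulr // chinese_modl // coprime_level.
have yr_p n : yr n = (bi n * z n)%N %[mod p ^ n].
  by rewrite /yr modn_dvdm ?dvdn_mull // chinese_modr // coprime_level.
have yr_compat n : (yr n.+1 %% (d * p ^ n) = yr n)%N.
  rewrite -[RHS](modn_mod _ (d * p ^ n)); apply: eq_mod_level.
    by rewrite yr_d yr_d.
  rewrite (eqmod_dvd (dvdn_exp2l p (leqnSn n)) (yr_p n.+1)) yr_p.
  have biE : bi n.+1 = bi n %[mod p ^ n].
    by rewrite -[(p ^ n)%N]mul1n !residue_mod.
  by rewrite -modnMm biE (residue_mod_p z (leqnSn n)) modnMm.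
exists (MkXd yr_compat).
  rewrite /Xball /=; apply: eq_mod_level; first exact: yr_d.
  rewrite yr_p -modnMmr zxp.
  by rewrite modnMmr mulnA [(bi N * _)%N]mulnC -modnMml inverse_mod // modnMml mul1n.
apply: Xd_ext => n /=; rewrite -[RHS](residue_small d_gt0).
apply: eq_mod_level.
  rewrite -modnMm yr_d residue_mod_d modnMm [RHS]residue_mod_d.
  by rewrite -(residue_mod_d z N) zxd -[RHS]modnMml residue_mod_d modnMml.
by rewrite -modnMmr yr_p modnMmr mulnA -modnMml inverse_mod // modnMml mul1n.
Qed.

Lemma sum_unit_dilate (F : nat -> K) D b : (0 < D)%N -> coprime b D ->
  (forall x, F (x %% D)%N = F x) -> \sum_(x < D) F (b * x)%N = \sum_(x < D) F x.
Proof.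
move=> D0 cop Fper.
pose h (x : 'I_D) := Ordinal (ltn_pmod (b * x) D0).
have h_inj : injective h.
  move=> x y [xy]; apply/val_inj.
  have back (z : 'I_D) : (inv_mod D b * ((b * z) %% D) %% D = z)%N.
    by rewrite modnMmr mulnCA mulnA -modnMml inv_modP // modnMml mul1n modn_small.
  by rewrite /= -(back x) xy back.
by rewrite [RHS](reindex_inj h_inj); apply: eq_bigr => x _; rewrite /= Fper.
Qed.

Context (chi : nat -> K) (chi_cond : dirichlet_of_conductor d chi).

Lemma chi_frac_mul a b : chi_frac d chi a b = chi a * chi_frac d chi 1 b.
Proof.
by rewrite /chi_frac mul1n; case: ifP; rewrite ?mulr0 // (dir_mul chi_cond).
Qed.

(** If b is invertible modulo d, substitute x for b x. Otherwise let
    g = gcd(b, d) > 1. As d / g is a proper divisor of the conductor, chi n <> 1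
    for some unit n = 1 modulo d / g. Then b n = b modulo d, so multiplying x by a
    lift of n that is 1 modulo p^N leaves G (b x) unchanged and scales the sum by
    chi n; hence the sum is 0. *)
Lemma sum_chi_dilate (G : nat -> K) N b b0 :
  coprime b (p ^ N) -> b = b0 %[mod d] ->
  (forall x, G (x %% (d * p ^ N))%N = G x) ->
  \sum_(x < d * p ^ N) chi x * G (b * x)%N
  = chi_frac d chi 1 b0 * \sum_(x < d * p ^ N) chi x * G x.
Proof.
move=> cop_bp bb0 Gper; set D := (d * p ^ N)%N in Gper *.
have D0 : (0 < D)%N by exact: level_gt0.
have chi_per x : chi (x %% D)%N = chi x by exact: chi_mod.
rewrite /chi_frac -coprime_modl -bb0 coprime_modl mul1n; case: ifP => cop_bd.
  have inv_b : (b * inv_mod d b0 = 1 %[mod d])%N.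
    rewrite -modnMml bb0 modnMml inv_modP //.
    by rewrite -coprime_modl -bb0 coprime_modl.
  rewrite mulr_sumr.
  rewrite -(@sum_unit_dilate (fun x => chi (inv_mod d b0) * (chi x * G x)) D b) //.
  - apply: eq_bigr => x _; rewrite mulrA -(dir_mul chi_cond); congr (_ * _).
    apply: (dir_period chi_cond).
    by rewrite mulnCA mulnA -modnMml inv_b modnMml mul1n.
  - by rewrite coprimeMr cop_bd.
  by move=> x; rewrite chi_per Gper.
rewrite mul0r; set g := gcdn b d.
have g0 : (0 < g)%N by rewrite gcdn_gt0 d_gt0 orbT.
have g1 : (1 < g)%N by rewrite ltn_neqAle eq_sym -/(coprime b d) cop_bd.
have dE : d = (g * (d %/ g))%N by rewrite mulnC divnK ?dvdn_gcdr.
have [n [cop_nd n1 chin]] : exists n,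
    [/\ coprime n d, n = 1 %[mod d %/ g] & chi n <> 1].
  apply: (dir_prim chi_cond); first by rewrite {2}dE dvdn_mull.
  by rewrite ltn_Pdiv.
have bn_d : (b * n = b %[mod d])%N.
  rewrite -(divnK (dvdn_gcdl b d)) -/g -mulnA -modnMmr [in LHS]dE.
  by rewrite -muln_modr n1 muln_modr -dE modnMmr muln1.
(* The lift of n is 1 modulo p^N, so that b n' = b modulo p^N as well. *)
pose n' := chinese d (p ^ N) n 1.
have n'd : n' = n %[mod d] by rewrite chinese_modl // coprime_level.
have n'p : n' = 1 %[mod p ^ N] by rewrite chinese_modr // coprime_level.
have cop_n'D : coprime n' D.
  rewrite coprimeMr -coprime_modl n'd coprime_modl cop_nd.
  by rewrite -coprime_modl n'p coprime_modl coprime1n.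
set F := fun x => chi x * G (b * x)%N; set S := \sum_(_ < _) _.
have bn'x x : (b * (n' * x) = b * x %[mod D])%N.
  rewrite mulnA -modnMml -[RHS]modnMml; congr (_ * _ %% _)%N.
  apply: eq_mod_level; first by rewrite -modnMmr n'd modnMmr.
  by rewrite -modnMmr n'p modnMmr muln1.
have SE : S = chi n * S.
  rewrite {1}/S -(@sum_unit_dilate F D n') //; last first.
    by move=> x; rewrite /F chi_per -Gper modnMmr Gper.
  rewrite mulr_sumr; apply: eq_bigr => x _.
  rewrite /F (dir_mul chi_cond) (dir_period chi_cond n'd) -mulrA.
  by rewrite -Gper bn'x Gper.
apply/eqP; move: SE => /eqP; rewrite -subr_eq0 -{1}[S]mul1r -mulrBl mulf_eq0.
by rewrite subr_eq0 => /orP[/eqP /esym|].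
Qed.

Context (alpha : nat) (alpha_gt0 : (0 < alpha)%N) (k : nat).
Context (beta : Xd p d) (beta_star : Xstar beta).

Lemma dilate_mu_Xball q N x :
  dilate beta (mu nv p d alpha k q) (Xball N x)
  = mu nv p d alpha k q (Xball N (beta N * x)).
Proof. by rewrite /dilate Xmul_Xball // Xstar_coprime. Qed.

Lemma sum_dilate_X q N : qbase q ->
  \sum_(x < d * p ^ N) chi x * dilate beta (mu nv p d alpha k q) (Xball N x)
  = chi_frac d chi 1 (beta 0%N) * gen_qbern nv p d alpha k chi q.
Proof.
move=> qb; under eq_bigr do rewrite dilate_mu_Xball.
rewrite -(sum_mu_X alpha_gt0 d_gt0 k chi_cond N qb).
apply: (sum_chi_dilate (G := fun x => mu nv p d alpha k q (Xball N x))).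
- by case: N => [|N]; rewrite ?coprimen1 // coprimeXr // Xstar_coprime.
- exact: residue_mod_d.
by move=> x; rewrite mu_Xball_periodic.
Qed.

Lemma sum_dilate_pX q N : qbase q ->
  \sum_(x < d * p ^ N)
     chi (p * x)%N * dilate beta (mu nv p d alpha k q) (Xball N.+1 (p * x))
  = chi_frac d chi p (beta 0%N) * (qint (q ^+ alpha) p ^+ k / qint q p)
      * gen_qbern nv p d alpha k chi (q ^+ p).
Proof.
move=> qb; pose G x := mu nv p d alpha k q (Xball N.+1 (p * x)).
have levelS : (p * (d * p ^ N) = d * p ^ N.+1)%N by rewrite expnS mulnCA.
have Gper x : G (x %% (d * p ^ N))%N = G x.
  by rewrite /G muln_modr levelS mu_Xball_periodic.
have bS : beta N.+1 = beta 0%N %[mod d] := residue_mod_d beta N.+1.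
have cop : coprime (beta N.+1) (p ^ N) by rewrite coprimeXr // Xstar_coprime.
transitivity (chi p * \sum_(x < d * p ^ N) chi x * G (beta N.+1 * x)%N).
  rewrite mulr_sumr; apply: eq_bigr => x _.
  by rewrite dilate_mu_Xball (dir_mul chi_cond) -mulrA mulnCA /G.
rewrite (sum_chi_dilate cop bS Gper) (chi_frac_mul p) mulrCA.
rewrite [chi p * chi_frac _ _ _ _]mulrC -2![RHS]mulrA; congr (_ * _); rewrite [RHS]mulrA.
rewrite -(sum_mu_pX alpha_gt0 d_gt0 k chi_cond N qb) mulr_sumr.
by apply: eq_bigr => x _; rewrite (dir_mul chi_cond) mulrA.
Qed.

End Dilation.
End Ultrametric.

Theorem theorem5 (R : realType) (K : fieldType) (nv : K -> R) (p : nat)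
    (p_prime : prime p) (K_Cp : is_Cp nv p)
    (q : K) (hq : nv (1 - q) < 1)
    (alpha k d : nat) (alpha_gt0 : (0 < alpha)%N) (d_gt0 : (0 < d)%N)
    (cop_pd : coprime p d)
    (hden : forall N : nat, qint q (d * p ^ N) != 0)
    (chi : nat -> K) (chi_cond : dirichlet_of_conductor d chi)
    (beta : Xd p d) (beta_star : Xstar beta) (beta_neq1 : beta <> Xnat p d 1) :
  let binv : Zadic p := Zadic_inv (toZadic beta) in
  let q_1b : K := Zpow nv q binv in
  let q_pb : K := Zpow nv q (Xmul (Xnat p 1 p) binv) in
  let q_ab : K := Zpow nv q (Xmul (Xnat p 1 alpha) binv) in
  [/\ has_int_X nv chi (mu nv p d alpha k q)
        (gen_qbern nv p d alpha k chi q),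
      has_int_pX nv chi (mu nv p d alpha k q)
        (chi p * (qint (q ^+ alpha) p ^+ k / qint q p)
          * gen_qbern nv p d alpha k chi (q ^+ p)),
      has_int_pX nv chi (dilate beta (mu nv p d alpha k q_1b))
        (chi_frac d chi p (beta 0%N) * (qint q_ab p ^+ k / qint q_1b p)
          * gen_qbern nv p d alpha k chi q_pb)
    & has_int_X nv chi (dilate beta (mu nv p d alpha k q_1b))
        (chi_frac d chi 1 (beta 0%N) * gen_qbern nv p d alpha k chi q_1b)].
Proof.
move=> binv q_1b q_pb q_ab.
have qb : qbase nv q := qbase_level p_prime K_Cp d_gt0 hq hden.
have beta_unit : coprime (beta 1%N) p := Xstar_coprime d_gt0 0 beta_star.
have qb_1b : qbase nv q_1b.
  apply: (qbase_Zpow p_prime K_Cp (b := beta) qb) => N.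
  exact: inverse_mod.
have q_mulE m : Zpow nv q (Xmul (Xnat p 1 m) binv) = q_1b ^+ m.
  apply: (Zpow_muln p_prime K_Cp hq) => N.
  by rewrite /= mul1n modn_mod modnMml.
rewrite /q_pb /q_ab !q_mulE.
(* The approximating sums are equal to their limits at every level. *)
split; move=> e e0; exists 0%N => N _.
- by rewrite (sum_mu_X p_prime K_Cp) // subrr (nv0 K_Cp).
- by rewrite (sum_mu_pX p_prime K_Cp) // subrr (nv0 K_Cp).
- by rewrite (sum_dilate_pX p_prime K_Cp) // subrr (nv0 K_Cp).
- by rewrite (sum_dilate_X p_prime K_Cp) // subrr (nv0 K_Cp).
Qed.
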